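(* Let $k\ge 1$ and let $H$ be the subgroup of $\mathrm{Aut}(X^* )$ generated by the automorphisms defined by the wreath recursions $r_0=\sigma(\mathrm{id},\mathrm{id})$, $r_i=(r_{i-1},\mathrm{id})$ for $1\le i\le k$, $b_0=(r_k,b_1)$, $b_1=(r_k,b_2)$, $b_2=(\mathrm{id},b_0)$. Then the topological closure $\overline{H}$ of $H$ in $\mathrm{Aut}(X^* )$ is a topologically finitely generated, finitely constrained group defined by patterns of size $d=k+4$, and $\mathrm{Hdim}(\overline{H})=1-\frac{2}{2^{d-1}}$.
   Context: Let $X=\{0,1\}$ and let $X^*$ be the rooted binary tree of finite words. $G=\mathrm{Aut}(X^* )$. For $g\in G$ and $w\in X^*$ the section $g_w$ is defined by $g(wv)=g(w)g_w(v)$. Wreath recursion: $g=\sigma^{\varepsilon}(g_0,g_1)$ means $g(xw)=\sigma^\varepsilon(x)g_x(w)$ for $x\in X$, where $\sigma$ swaps $0$ and $1$ and $\sigma^0$ is the identity. $G(d)$ is the automorphism group of the finite tree of words of length $\le d$, $\pi_k$ is restriction to words of length $\le k$, $H(k)=\pi_k(H)$. A subgroup $P\le G(d)$ is an essential pattern group if for every $p\in P$ and $i\in\{0,1\}$ there is $q\in P$ with $\pi_{d-1}(q)=p_i$; $G_P=\{g\in G:\pi_d(g_w)\in P\ \forall w\}$. A subgroup is finitely constrained if it equals some $G_P$, and defined by patterns of size $d$ if $d$ is the minimal such size. A closed subgroup is topologically finitely generated if it has a finitely generated dense subgroup (profinite topology). $\mathrm{Hdim}(K)=\liminf_n\log_2|K(n)|/\log_2|G(n)|$.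 *)

(* Defs.v *)
From Stdlib Require Import Reals List Arith.
Import ListNotations.

(* Words over X = {0,1}: 0 = false, 1 = true.  A tree map is a function on words. *)
Definition word := list bool.
Definition tmap := word -> word.

Definition is_aut (g : tmap) : Prop :=
  (forall w, length (g w) = length w) /\
  (forall w x, exists y, g (w ++ [x]) = g w ++ [y]) /\
  (exists h : tmap, forall w, h (g w) = w /\ g (h w) = w).

(* sect g_w, defined by g(wv) = g(w) g_w(v) *)
Definition sect (g : tmap) (w : word) : tmap :=
  fun v => skipn (length w) (g (w ++ v)).

Definition eq_upto (n : nat) (g h : tmap) : Prop :=
  forall w, (length w <= n)%nat -> g w = h w.

Inductive gen_sub (gens : list tmap) : tmap -> Prop :=
  | gen_id : gen_sub gens (fun w => w)
  | gen_base : forall s, In s gens -> gen_sub gens s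
  | gen_mul : forall g h, gen_sub gens g -> gen_sub gens h ->
      gen_sub gens (fun w => g (h w))
  | gen_inv : forall g h, gen_sub gens g ->
      (forall w, h (g w) = w /\ g (h w) = w) -> gen_sub gens h.

Definition closure (S : tmap -> Prop) (g : tmap) : Prop :=
  is_aut g /\ forall n, exists h, S h /\ eq_upto n g h.

Definition top_fin_gen (K : tmap -> Prop) : Prop :=
  exists gens : list tmap, (forall s, In s gens -> K s) /\
    (forall g, K g -> closure (gen_sub gens) g).

(* A pattern group P <= G(d) is encoded by its full preimage pi_d^{-1}(P) in G:
   a subgroup of G which is a union of classes of eq_upto d. *)
Definition pattern_group (d : nat) (P : tmap -> Prop) : Prop :=
  (forall g, P g -> is_aut g) /\
  (forall g h, P g -> is_aut h -> eq_upto d g h -> P h) /\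
  P (fun w => w) /\
  (forall g h, P g -> P h -> P (fun w => g (h w))) /\
  (forall g h, P g -> (forall w, h (g w) = w /\ g (h w) = w) -> P h).

Definition essential (d : nat) (P : tmap -> Prop) : Prop :=
  forall p (i : bool), P p -> exists q, P q /\ eq_upto (d - 1) q (sect p [i]).

Definition G_P (d : nat) (P : tmap -> Prop) (g : tmap) : Prop :=
  is_aut g /\ forall w, P (sect g w).

Definition defined_by_patterns_of_size (K : tmap -> Prop) (d : nat) : Prop :=
  (exists P, pattern_group d P /\ essential d P /\ forall g, K g <-> G_P d P g) /\
  (forall d' P, (d' < d)%nat -> pattern_group d' P -> essential d' P ->
     ~ (forall g, K g <-> G_P d' P g)).

Fixpoint words (n : nat) : list word :=
  match n with
  | O => [[]]
  | S m => map (cons false) (words m) ++ map (cons true) (words m)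
  end.
Definition words_upto (n : nat) : list word := flat_map words (seq 0 (S n)).

Definition level_card (K : tmap -> Prop) (n m : nat) : Prop :=
  exists s : list (list word), NoDup s /\ length s = m /\
    forall f, In f s <-> exists g, K g /\ map g (words_upto n) = f.

Open Scope R_scope.

Definition is_liminf (u : nat -> R) (L : R) : Prop :=
  (forall eps, eps > 0 -> exists N, forall n, (n >= N)%nat -> u n > L - eps) /\
  (forall eps, eps > 0 -> forall N, exists n, (n >= N)%nat /\ u n < L + eps).

Definition hdim_is (K : tmap -> Prop) (L : R) : Prop :=
  exists a b : nat -> nat,
    (forall n, level_card K n (a n)) /\ (forall n, level_card is_aut n (b n)) /\
    is_liminf (fun n => (ln (INR (a n)) / ln 2) / (ln (INR (b n)) / ln 2)) L.

Close Scope R_scope.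

Fixpoint rfun (i : nat) (w : word) : word :=
  match i, w with
  | _, [] => []
  | O, x :: v => negb x :: v
  | S j, false :: v => false :: rfun j v
  | S j, true :: v => true :: v
  end.

Fixpoint bfun (k j : nat) (w : word) {struct w} : word :=
  match w with
  | [] => []
  | x :: v =>
    match j with
    | O => if x then true :: bfun k 1 v else false :: rfun k v
    | 1 => if x then true :: bfun k 2 v else false :: rfun k v
    | _ => if x then true :: bfun k 0 v else false :: v
    end
  end.

Definition gensH (k : nat) : list tmap :=
  map rfun (seq 0 (S k)) ++ [bfun k 0; bfun k 1; bfun k 2].

Definition H (k : nat) : tmap -> Prop := gen_sub (gensH k).

(* Main.v *)
Require Import Defs.
From Stdlib Require Import Reals List Arith Lia Lra Bool.
From Stdlib Require Import FunctionalExtensionality Classical Permutation.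
Import ListNotations.

(** Let [s_n(g)] be the parity of the number of active vertices of [g] on level [n]; each [s_n]
    is a homomorphism to Z/2.  Every [g] in [H] satisfies the two conditions
    [s_k(g_x) = s_{k+1}(g_y) + s_{k+2}(g_y)] for [{x,y} = {0,1}], which only involve words of
    length at most [k+4] and define the pattern group.  Conversely, if [h_0, h_1] are in [H] and
    satisfy these conditions, then [(h_0,h_1)] is in [H]: modulo the elements [x] with [(x,1)] in
    [H], the group [H] is generated by the images of [r_k] and [b_1], which commute because
    [(r_k,b_2)] and [(b_1,r_k)] are in [H] and [b_2] commutes with [r_k].  Induction on [n] shows
    that every element with the right patterns agrees with an element of [H] on words of length
    [n]; up to length [k+3] this holds for every automorphism, since [b_2] acts trivially on words
    of length [k+2] but has [s_{k+2} = 1], so no smaller pattern size can work.  For the dimension,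
    the pair [(s_k, s_{k+1} + s_{k+2})] is equidistributed, so from level [k+3] on
    |K(n+1)| = |K(n)|^2 / 2. *)

(** * Automorphisms, wreath recursion and sections *)

Definition idm : tmap := fun w => w.
Definition comp (g h : tmap) : tmap := fun w => g (h w).
Definition inverse_of (g h : tmap) : Prop := forall w, h (g w) = w /\ g (h w) = w.

(** The element [sigma^e (g0, g1)] of the wreath recursion; sections are indexed by the letter
    before the swap. *)
Definition mk (e : bool) (g0 g1 : tmap) : tmap := fun w =>
  match w with
  | [] => []
  | x :: v => xorb e x :: (if x then g1 v else g0 v)
  end.

(** The right factor acts first, so its swap [f] decides which section of the left factor each [h_x]
    meets. *)
Lemma mk_comp e g0 g1 f h0 h1 :
  comp (mk e g0 g1) (mk f h0 h1) =
  mk (xorb e f) (comp (if f then g1 else g0) h0) (comp (if f then g0 else g1) h1).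
Proof.
  apply functional_extensionality; intros [|x v]; unfold comp; simpl; auto.
  destruct e, f, x; reflexivity.
Qed.

Lemma mk_id : mk false idm idm = idm.
Proof.
  apply functional_extensionality; intros [|[] v]; reflexivity.
Qed.

Lemma sect_mk e g0 g1 x : sect (mk e g0 g1) [x] = if x then g1 else g0.
Proof. apply functional_extensionality; intros v; destruct x; reflexivity. Qed.

Lemma sect_cons g x w : sect g (x :: w) = sect (sect g [x]) w.
Proof.
  apply functional_extensionality; intros v; unfold sect; simpl.
  destruct (g (x :: w ++ v)); simpl; [now rewrite skipn_nil | reflexivity].
Qed.

Lemma aut_id : is_aut idm.
Proof.
  split; [reflexivity | split].
  - intros w x; exists x; reflexivity.
  - exists idm; split; reflexivity.
Qed.

Lemma aut_comp g h : is_aut g -> is_aut h -> is_aut (comp g h).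
Proof.
  intros (lg & pg & ig & Hg) (lh & ph & ih & Hh); split; [|split].
  - intros w; unfold comp; rewrite lg; apply lh.
  - intros w x; unfold comp.
    destruct (ph w x) as [y ->]; apply pg.
  - exists (comp ih ig); intros w; unfold comp; split.
    + now rewrite (proj1 (Hg _)), (proj1 (Hh _)).
    + now rewrite (proj2 (Hh _)), (proj2 (Hg _)).
Qed.

Lemma aut_inv g h : is_aut g -> inverse_of g h -> is_aut h.
Proof.
  intros (lg & pg & _) Hh.
  assert (lh : forall w, length (h w) = length w).
  { intros w; rewrite <- (lg (h w)); f_equal; apply Hh. }
  split; [exact lh | split].
  - intros w x.
    (* Applying [g] to [h (w ++ [x])] with its last letter split off shows that the remaining prefix
       [u] is sent to [w], hence is [h w]. *)
    destruct (exists_last (l := h (w ++ [x]))) as (u & y & E).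
    { intros E; apply (f_equal (@length _)) in E.
      rewrite lh, length_app in E; simpl in E; lia. }
    exists y; rewrite E; f_equal.
    destruct (pg u y) as [z Ez].
    rewrite <- E, (proj2 (Hh _)) in Ez.
    apply app_inj_tail in Ez; destruct Ez as [-> _].
    symmetry; apply Hh.
  - exists g; intros w; split; apply Hh.
Qed.

Lemma aut_mk e g0 g1 : is_aut g0 -> is_aut g1 -> is_aut (mk e g0 g1).
Proof.
  intros (l0 & p0 & i0 & H0) (l1 & p1 & i1 & H1); split; [|split].
  - intros [|[] v]; simpl; auto.
  - intros [|[] v] x; simpl.
    + exists (xorb e x).
      assert (E0 := l0 []); assert (E1 := l1 []).
      destruct x, (g0 []), (g1 []); simpl in *; try discriminate; reflexivity.
    + destruct (p1 v x) as [y ->]; exists y; reflexivity.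
    + destruct (p0 v x) as [y ->]; exists y; reflexivity.
  - exists (mk e (if e then i1 else i0) (if e then i0 else i1)).
    intros [|x v]; [split; reflexivity|].
    destruct e, x; simpl;
      rewrite ?(proj1 (H0 _)), ?(proj1 (H1 _)), ?(proj2 (H0 _)), ?(proj2 (H1 _));
      split; reflexivity.
Qed.

Lemma aut_nil g : is_aut g -> g [] = [].
Proof. intros (l & _); specialize (l []); destruct (g []); [auto|discriminate]. Qed.

(** Compatibility with appending one letter, iterated along [v], makes [g w] a prefix of
    [g (w ++ v)]; preservation of length then makes [skipn] cut exactly there. *)
Lemma aut_app g w v : is_aut g -> g (w ++ v) = g w ++ sect g w v.
Proof.
  intros Hg.
  assert (E : exists u, g (w ++ v) = g w ++ u).
  { destruct Hg as (l & p & _).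
    induction v as [|x v IH] using rev_ind.
    - exists []; now rewrite !app_nil_r.
    - destruct IH as [u IH]; rewrite app_assoc.
      destruct (p (w ++ v) x) as [y ->]; rewrite IH.
      exists (u ++ [y]); now rewrite app_assoc. }
  destruct E as [u E]; unfold sect; rewrite E.
  rewrite <- (proj1 Hg w), skipn_app, skipn_all, Nat.sub_diag; reflexivity.
Qed.

Lemma aut_mk_rev e g0 g1 : is_aut (mk e g0 g1) -> is_aut g0 /\ is_aut g1.
Proof.
  intros (l & p & h & Hh).
  assert (Hx : forall x : bool, is_aut (if x then g1 else g0)).
  { intros x.
    assert (Ex : forall v, mk e g0 g1 (x :: v) = xorb e x :: (if x then g1 else g0) v)
      by (intros v; destruct x; reflexivity).
    split; [|split].
    - intros v; specialize (l (x :: v)); rewrite Ex in l; simpl in l; lia.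
    - intros v y; destruct (p (x :: v) y) as [z Ez]; exists z.
      rewrite <- app_comm_cons in Ez; rewrite !Ex in Ez; now inversion Ez.
    (* The inverse of a section strips the first letter from the inverse [h] of the whole map. *)
    - exists (fun v => tl (h (xorb e x :: v))); intros v; split.
      + now rewrite <- Ex, (proj1 (Hh _)).
      + assert (E := proj2 (Hh (xorb e x :: v))).
        destruct (h (xorb e x :: v)) as [|y u]; [discriminate|].
        simpl in E; inversion E as [[E1 E2]].
        assert (y = x) by (destruct e, x, y; auto; discriminate).
        subst y; simpl; destruct x; exact E2 || reflexivity. }
  split; [exact (Hx false) | exact (Hx true)].
Qed.

(** Injectivity forces the two letters to have different images, so the image of [0] alone tells
    whether the root is active. *)
Lemma aut_eta g : is_aut g ->
  g = mk (hd false (g [false])) (sect g [false]) (sect g [true]).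
Proof.
  intros Hg; apply functional_extensionality; intros [|x v]; [now apply aut_nil|].
  change (x :: v) with ([x] ++ v); rewrite (aut_app g [x] v Hg).
  assert (E0 := proj1 Hg [false]); assert (E1 := proj1 Hg [true]).
  destruct (g [false]) as [|y0 [|]] eqn:F0; try discriminate.
  destruct (g [true]) as [|y1 [|]] eqn:F1; try discriminate.
  assert (y0 <> y1).
  { intros ->; destruct Hg as (_ & _ & h & Hh).
    assert (E := proj1 (Hh [false])); rewrite F0, <- F1, (proj1 (Hh _)) in E.
    discriminate. }
  destruct x; [rewrite F1|rewrite F0]; simpl; destruct y0, y1; reflexivity || congruence.
Qed.

Lemma aut_sect1 g x : is_aut g -> is_aut (sect g [x]).
Proof.
  intros Hg; rewrite (aut_eta g Hg) in Hg; apply aut_mk_rev in Hg.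
  destruct x; apply Hg.
Qed.

Lemma aut_sect g w : is_aut g -> is_aut (sect g w).
Proof.
  revert g; induction w as [|x w IH]; intros g Hg; [exact Hg|].
  rewrite sect_cons; now apply IH, aut_sect1.
Qed.

(** Reduces claims about an automorphism to the wreath form, where composition and parities
    compute. *)
Lemma aut_cases (Q : tmap -> Prop) :
  (forall e g0 g1, is_aut g0 -> is_aut g1 -> Q (mk e g0 g1)) ->
  forall g, is_aut g -> Q g.
Proof.
  intros HQ g Hg; rewrite (aut_eta g Hg); apply HQ; now apply aut_sect1.
Qed.

Lemma eq_upto_sect n g h w :
  eq_upto (length w + n) g h -> eq_upto n (sect g w) (sect h w).
Proof.
  intros E v Hv; unfold sect; rewrite E; [reflexivity|]; rewrite length_app; lia.
Qed.

Lemma eq_upto_mk n e g0 g1 f h0 h1 :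
  eq_upto (S n) (mk e g0 g1) (mk f h0 h1) <->
  e = f /\ eq_upto n g0 h0 /\ eq_upto n g1 h1.
Proof.
  split.
  - intros E; split; [|split].
    + specialize (E [false] ltac:(simpl; lia)); simpl in E.
      destruct e, f; simpl in E; congruence.
    + intros v Hv; specialize (E (false :: v) ltac:(simpl; lia)); simpl in E; congruence.
    + intros v Hv; specialize (E (true :: v) ltac:(simpl; lia)); simpl in E; congruence.
  - intros (-> & E0 & E1) [|[] v] Hv; simpl in *; auto;
      [rewrite E1 | rewrite E0]; auto; lia.
Qed.

Lemma eq_upto_refl n g : eq_upto n g g.
Proof. intros w _; reflexivity. Qed.

Lemma eq_upto_le m n g h : m <= n -> eq_upto n g h -> eq_upto m g h.
Proof. intros Hm E w Hw; apply E; lia. Qed.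

(** * Parities of active vertices on a level *)

(** On automorphisms this is the parity [s_n]: the root is active exactly when [0] is sent to
    [true]. The default of [hd] does not occur there, as lengths are preserved. *)
Fixpoint par (n : nat) (g : tmap) : bool :=
  match n with
  | O => hd false (g [false])
  | S m => xorb (par m (sect g [false])) (par m (sect g [true]))
  end.

Lemma par_mk_0 e g0 g1 : par 0 (mk e g0 g1) = e.
Proof. destruct e; reflexivity. Qed.

Lemma par_mk_S n e g0 g1 : par (S n) (mk e g0 g1) = xorb (par n g0) (par n g1).
Proof. simpl; now rewrite !sect_mk. Qed.

Lemma par_id n : par n idm = false.
Proof.
  induction n as [|n IH]; [reflexivity|].
  now rewrite <- mk_id, par_mk_S, IH.
Qed.

(** The inner swap only permutes the sections of [g], and a sum modulo 2 does not see the order. *)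
Lemma par_comp n g h : is_aut g -> is_aut h -> par n (comp g h) = xorb (par n g) (par n h).
Proof.
  revert g h; induction n as [|n IH]; intros g h Hg Hh; revert h Hh; pattern g;
    revert g Hg; apply (aut_cases); intros e g0 g1 H0 H1; apply aut_cases;
    intros f h0 h1 K0 K1; rewrite mk_comp.
  - now rewrite !par_mk_0.
  - rewrite !par_mk_S, !IH by (destruct f; assumption).
    destruct f, (par n g0), (par n g1), (par n h0), (par n h1); reflexivity.
Qed.

(** Activity of a vertex on level [n] shows on words of length [n + 1], hence the strict
    inequality. *)
Lemma par_eq_upto n m g h : n < m -> eq_upto m g h -> par n g = par n h.
Proof.
  revert m g h; induction n as [|n IH]; intros m g h Hm E; simpl.
  - rewrite E; [reflexivity | simpl; lia].
  - assert (F : forall x, eq_upto (m - 1) (sect g [x]) (sect h [x])).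
    { intros x; apply eq_upto_sect; simpl; now replace (S (m - 1)) with m by lia. }
    f_equal; apply (IH (m - 1)); auto; lia.
Qed.

(** * The generators [r_i] and [b_j] *)

Lemma rfun_0 : rfun 0 = mk true idm idm.
Proof. apply functional_extensionality; intros [|[] v]; reflexivity. Qed.

Lemma rfun_S i : rfun (S i) = mk false (rfun i) idm.
Proof. apply functional_extensionality; intros [|[] v]; reflexivity. Qed.

Lemma bfun_0 k : bfun k 0 = mk false (rfun k) (bfun k 1).
Proof. apply functional_extensionality; intros [|[] v]; reflexivity. Qed.

Lemma bfun_1 k : bfun k 1 = mk false (rfun k) (bfun k 2).
Proof. apply functional_extensionality; intros [|[] v]; reflexivity. Qed.

Lemma bfun_2 k : bfun k 2 = mk false idm (bfun k 0).
Proof. apply functional_extensionality; intros [|[] v]; reflexivity. Qed.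

Lemma rfun_invol i : comp (rfun i) (rfun i) = idm.
Proof.
  induction i as [|i IH]; rewrite ?rfun_0, ?rfun_S, mk_comp; [apply mk_id|].
  simpl; rewrite IH; apply mk_id.
Qed.

(** The three maps call one another, so all are treated at once by induction on the word. *)
Lemma bfun_invol_all k w :
  bfun k 0 (bfun k 0 w) = w /\ bfun k 1 (bfun k 1 w) = w /\
  bfun k 2 (bfun k 2 w) = w.
Proof.
  induction w as [|[] w (I0 & I1 & I2)]; [repeat split | |].
  - simpl; rewrite I0, I1, I2; auto.
  - assert (E : rfun k (rfun k w) = w) by exact (f_equal (fun g => g w) (rfun_invol k)).
    simpl; rewrite E; auto.
Qed.

Lemma bfun_invol k j : j <= 2 -> comp (bfun k j) (bfun k j) = idm.
Proof.
  intros Hj; apply functional_extensionality; intros w.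
  destruct (bfun_invol_all k w) as (I0 & I1 & I2).
  destruct j as [|[|[|]]]; [exact I0|exact I1|exact I2|lia].
Qed.

Lemma rfun_aut i : is_aut (rfun i).
Proof.
  induction i; rewrite ?rfun_0, ?rfun_S; apply aut_mk; auto using aut_id.
Qed.

Lemma bfun_aut k j : j <= 2 -> is_aut (bfun k j).
Proof.
  intros Hj; split; [|split].
  - assert (L : forall w, length (rfun k w) = length w) by apply rfun_aut.
    intros w; revert j Hj; induction w as [|x w IH]; intros [|[|[|]]] Hj; simpl; auto; try lia;
    destruct x; simpl; rewrite ?L, ?IH; auto.
  - intros w x; revert j Hj; induction w as [|y w IH]; intros j Hj.
    + exists x. destruct j as [|[|j]], x; simpl; try reflexivity;
        now rewrite (aut_nil _ (rfun_aut k)).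
    + destruct (proj1 (proj2 (rfun_aut k)) w x) as [z Ez].
      destruct j as [|[|[|]]], y; try lia; simpl; rewrite ?Ez; eauto.
      * destruct (IH 1 ltac:(lia)) as [u ->]; eauto.
      * destruct (IH 2 ltac:(lia)) as [u ->]; eauto.
      * destruct (IH 0 ltac:(lia)) as [u ->]; eauto.
  - exists (bfun k j); intros w; split; exact (f_equal (fun g => g w) (bfun_invol k j Hj)).
Qed.

(** The only active vertex of [r_i] is [0^i]. *)
Lemma par_rfun n i : par n (rfun i) = (n =? i).
Proof.
  revert i; induction n as [|n IH]; intros [|i]; rewrite ?rfun_0, ?rfun_S,
    ?par_mk_0, ?par_mk_S, ?par_id, ?IH, ?xorb_false_r; reflexivity.
Qed.

(** All activity of the [b_j] comes from copies of [r_k] hanging at level one or deeper. *)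
Lemma par_bfun_small k n :
  n <= k -> par n (bfun k 0) = false /\ par n (bfun k 1) = false /\ par n (bfun k 2) = false.
Proof.
  induction n as [|n IH]; intros Hn; [repeat split|].
  destruct IH as (I0 & I1 & I2); [lia|].
  assert (E : par n (rfun k) = false) by (rewrite par_rfun; apply Nat.eqb_neq; lia).
  rewrite bfun_0, par_mk_S, E, I1, bfun_1, par_mk_S, E, I2, bfun_2, par_mk_S, par_id, I0.
  auto.
Qed.

Lemma par_bfun_S k :
  par (S k) (bfun k 0) = true /\ par (S k) (bfun k 1) = true /\ par (S k) (bfun k 2) = false.
Proof.
  destruct (par_bfun_small k k (le_n k)) as (I0 & I1 & I2).
  rewrite bfun_0, par_mk_S, I1, bfun_1, par_mk_S, I2, bfun_2, par_mk_S, par_id, I0.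
  rewrite par_rfun, Nat.eqb_refl; auto.
Qed.

Lemma par_bfun_SS k :
  par (S (S k)) (bfun k 0) = true /\ par (S (S k)) (bfun k 1) = false /\
  par (S (S k)) (bfun k 2) = true.
Proof.
  destruct (par_bfun_S k) as (I0 & I1 & I2).
  rewrite bfun_0, par_mk_S, I1, bfun_1, par_mk_S, I2, bfun_2, par_mk_S, par_id, I0.
  rewrite par_rfun, (proj2 (Nat.eqb_neq _ _)) by lia; auto.
Qed.

Lemma eq_upto_mk_id n g0 g1 :
  eq_upto n g0 idm -> eq_upto n g1 idm -> eq_upto (S n) (mk false g0 g1) idm.
Proof. intros E0 E1; rewrite <- mk_id at 1; now apply eq_upto_mk. Qed.

Lemma rfun_upto i : eq_upto i (rfun i) idm.
Proof.
  induction i as [|i IH].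
  - intros [|x w] Hw; [reflexivity | simpl in Hw; lia].
  - rewrite rfun_S; apply eq_upto_mk_id; auto using eq_upto_refl.
Qed.

Lemma bfun_upto k n : n <= S k ->
  eq_upto n (bfun k 0) idm /\ eq_upto n (bfun k 1) idm /\ eq_upto n (bfun k 2) idm.
Proof.
  induction n as [|n IH]; intros Hn.
  - repeat split; intros [|x w] Hw; simpl in *; try reflexivity; lia.
  - destruct IH as (I0 & I1 & I2); [lia|].
    assert (E := eq_upto_le n k _ _ ltac:(lia) (rfun_upto k)).
    split; [|split]; [rewrite bfun_0 | rewrite bfun_1 | rewrite bfun_2];
      apply eq_upto_mk_id; auto using eq_upto_refl.
Qed.

(** The first copy of [r_k] in [b_2] hangs one level deeper than in [b_0] and [b_1], which gains one
    letter. *)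
Lemma bfun_2_upto k : eq_upto (S (S k)) (bfun k 2) idm.
Proof.
  rewrite bfun_2; apply eq_upto_mk_id; [apply eq_upto_refl|].
  now apply bfun_upto.
Qed.

(** * Induction over words in the generators and elementary operations in [H] *)

(** A product of involutions is inverted by reversing it, so every element of the group is a plain
    word in the generators, and induction on that word suffices. *)
Lemma gen_sub_ind_left (gens : list tmap) (Q : tmap -> Prop) :
  (forall s, In s gens -> comp s s = idm) ->
  Q idm -> (forall s h, In s gens -> gen_sub gens h -> Q h -> Q (comp s h)) ->
  forall g, gen_sub gens g -> Q g.
Proof.
  intros Hs Q0 QS.
  pose (prod := fold_right comp idm).
  assert (papp : forall l m, prod (l ++ m) = comp (prod l) (prod m)).
  { intros l m; induction l as [|s l IH]; [reflexivity|].
    simpl; now rewrite IH. }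
  assert (prev : forall l, (forall s, In s l -> In s gens) ->
            comp (prod l) (prod (rev l)) = idm).
  { induction l as [|s l IH]; intros Hl; [reflexivity|].
    simpl rev; rewrite papp.
    (* [comp] is associative and unital by conversion, so [change] regroups products at will, here
       and below. *)
    change (comp s (comp (comp (prod l) (prod (rev l))) (comp s idm)) = idm).
    rewrite IH; [|intros; apply Hl; now right].
    apply Hs, Hl; now left. }
  assert (W : forall g, gen_sub gens g ->
            exists l, (forall s, In s l -> In s gens) /\ g = prod l).
  { induction 1 as [| s Hin | g h _ (l & Hl & ->) _ (m & Hm & ->) | g h _ (l & Hl & ->) Hh].
    - exists []; split; [intros s []|reflexivity].
    - exists [s]; split; [intros t [<-|[]]; auto | reflexivity].
    - exists (l ++ m); split; [|now rewrite papp].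
      intros s Hin; apply in_app_or in Hin; destruct Hin; auto.
    - exists (rev l); split; [intros s Hin; apply Hl, in_rev; exact Hin|].
      transitivity (comp h (comp (prod l) (prod (rev l)))).
      + now rewrite prev.
      + apply functional_extensionality; intros w; apply (proj1 (Hh (prod (rev l) w))). }
  intros g Hg; destruct (W g Hg) as (l & Hl & ->); clear Hg.
  enough (gen_sub gens (prod l) /\ Q (prod l)) by tauto.
  induction l as [|s l IH]; [split; [apply gen_id | exact Q0]|].
  destruct IH as [H1 H2]; [intros; apply Hl; now right|].
  assert (In s gens) by (apply Hl; now left).
  split; [apply (gen_mul gens s (prod l)); auto; now apply gen_base|].
  now apply (QS s (prod l)).
Qed.

Lemma in_gensH k s :
  In s (gensH k) <-> (exists i, i <= k /\ s = rfun i) \/ (exists j, j <= 2 /\ s = bfun k j).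
Proof.
  unfold gensH; rewrite in_app_iff, in_map_iff; setoid_rewrite in_seq; split.
  - intros [(i & <- & Hi) | [<- | [<- | [<- | []]]]].
    + left; exists i; split; [lia | reflexivity].
    + right; exists 0; auto.
    + right; exists 1; auto.
    + right; exists 2; auto.
  - intros [(i & Hi & ->) | (j & Hj & ->)].
    + left; exists i; split; [reflexivity | lia].
    + right; destruct j as [|[|[|]]]; simpl; auto; lia.
Qed.

Lemma gensH_aut k s : In s (gensH k) -> is_aut s.
Proof.
  intros Hs; apply in_gensH in Hs; destruct Hs as [(i & _ & ->) | (j & Hj & ->)];
    auto using rfun_aut, bfun_aut.
Qed.

Lemma H_rfun k i : i <= k -> H k (rfun i).
Proof. intros Hi; apply gen_base, in_gensH; eauto. Qed.

Lemma H_bfun k j : j <= 2 -> H k (bfun k j).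
Proof. intros Hj; apply gen_base, in_gensH; eauto. Qed.

Lemma H_comp k g h : H k g -> H k h -> H k (comp g h).
Proof. apply gen_mul. Qed.

Lemma H_ind_left k (Q : tmap -> Prop) :
  Q idm -> (forall s h, In s (gensH k) -> H k h -> Q h -> Q (comp s h)) ->
  forall g, H k g -> Q g.
Proof.
  apply gen_sub_ind_left; intros s Hs; apply in_gensH in Hs.
  destruct Hs as [(i & _ & ->) | (j & Hj & ->)]; auto using rfun_invol, bfun_invol.
Qed.

Lemma H_aut k g : H k g -> is_aut g.
Proof.
  revert g; apply H_ind_left; [apply aut_id|].
  intros s h Hs _ Hh; apply aut_comp; auto; eapply gensH_aut; eauto.
Qed.

Lemma H_mk_comp k g0 g1 h0 h1 :
  H k (mk false g0 g1) -> H k (mk false h0 h1) -> H k (mk false (comp g0 h0) (comp g1 h1)).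
Proof.
  intros Hg Hh; assert (E := H_comp k _ _ Hg Hh); now rewrite mk_comp in E.
Qed.

(** Left multiplication by [r_0 = sigma] changes the root activity and keeps both sections. *)
Lemma H_mk_sigma k e g0 g1 : H k (mk false g0 g1) -> H k (mk e g0 g1).
Proof.
  intros Hg; destruct e; [|exact Hg].
  assert (E := H_comp k _ _ (H_rfun k 0 ltac:(lia)) Hg).
  now rewrite rfun_0, mk_comp in E.
Qed.

(** This is conjugation by [r_0]. *)
Lemma H_mk_swap k g0 g1 : H k (mk false g0 g1) -> H k (mk false g1 g0).
Proof.
  intros Hg; assert (E := H_comp k _ _ (H_mk_sigma k true _ _ Hg) (H_rfun k 0 ltac:(lia))).
  now rewrite rfun_0, mk_comp in E.
Qed.

(** * Which pairs [(h_0, h_1)] lie in [H] *)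

Lemma H_rk_b1 k : H k (mk false (rfun k) (bfun k 1)).
Proof. rewrite <- bfun_0; apply H_bfun; lia. Qed.

(* [b_1 = (r_k, b_2)] and [(b_1, r_k)] have commutator [([r_k, b_1], 1)],
   since for [k >= 1] the elements [b_2 = (1, b_0)] and [r_k = (r_{k-1}, 1)] commute. *)
Lemma H_commutator k : 1 <= k ->
  H k (mk false idm (comp (rfun k) (comp (bfun k 1) (comp (rfun k) (bfun k 1))))) /\
  H k (mk false idm (comp (bfun k 1) (comp (rfun k) (comp (bfun k 1) (rfun k))))).
Proof.
  intros Hk.
  assert (C : comp (bfun k 2) (rfun k) = comp (rfun k) (bfun k 2)).
  { destruct k as [|k']; [lia|].
    rewrite (bfun_2 (S k')), (rfun_S k'), !mk_comp; reflexivity. }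
  assert (R := rfun_invol k); assert (B := bfun_invol k 2 (le_n 2)).
  assert (X : H k (mk false (rfun k) (bfun k 2))).
  { rewrite <- bfun_1; apply H_bfun; lia. }
  assert (Y := H_mk_swap k _ _ (H_rk_b1 k)).
  split; apply H_mk_swap.
  - assert (E := H_mk_comp k _ _ _ _ X (H_mk_comp k _ _ _ _ Y (H_mk_comp k _ _ _ _ X Y))).
    replace (comp (bfun k 2) (comp (rfun k) (comp (bfun k 2) (rfun k)))) with idm in E;
      [exact E|].
    rewrite C at 1.
    change (idm = comp (comp (bfun k 2) (comp (rfun k) (rfun k))) (bfun k 2)).
    rewrite R; symmetry; exact B.
  - assert (E := H_mk_comp k _ _ _ _ Y (H_mk_comp k _ _ _ _ X (H_mk_comp k _ _ _ _ Y X))).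
    replace (comp (rfun k) (comp (bfun k 2) (comp (rfun k) (bfun k 2)))) with idm in E;
      [exact E|].
    rewrite <- C at 1.
    change (idm = comp (comp (rfun k) (comp (bfun k 2) (bfun k 2))) (rfun k)).
    rewrite B; symmetry; exact R.
Qed.

(* The exponent of [b_1] in the abelianization of [H k], in terms of parities. *)
Definition beta (k : nat) (g : tmap) : bool := xorb (par (k + 1) g) (par (k + 2) g).

Definition gpow (e : bool) (g : tmap) : tmap := if e then g else idm.

Lemma beta_comp k g h : is_aut g -> is_aut h -> beta k (comp g h) = xorb (beta k g) (beta k h).
Proof.
  intros Hg Hh; unfold beta; rewrite !par_comp by auto.
  destruct (par (k + 1) g), (par (k + 2) g), (par (k + 1) h), (par (k + 2) h); reflexivity.
Qed.

Lemma beta_id k : beta k idm = false.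
Proof. unfold beta; now rewrite !par_id. Qed.

Lemma beta_eq_upto k n g h : k + 3 <= n -> eq_upto n g h -> beta k g = beta k h.
Proof.
  intros Hn E; unfold beta; f_equal; apply (par_eq_upto _ n); auto; lia.
Qed.

Lemma beta_rfun k i : i <= k -> beta k (rfun i) = false.
Proof.
  intros Hi; unfold beta; rewrite !par_rfun, !(proj2 (Nat.eqb_neq _ _)) by lia; reflexivity.
Qed.

Lemma beta_bfun k :
  beta k (bfun k 0) = false /\ beta k (bfun k 1) = true /\ beta k (bfun k 2) = true.
Proof.
  unfold beta; replace (k + 1) with (S k) by lia; replace (k + 2) with (S (S k)) by lia.
  destruct (par_bfun_S k) as (-> & -> & ->), (par_bfun_SS k) as (-> & -> & ->); auto.
Qed.

Lemma gpow_mul e f g : comp g g = idm -> comp (gpow e g) (gpow f g) = gpow (xorb e f) g.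
Proof. intros E; destruct e, f; simpl; auto. Qed.

(** Each case is a generator or its mirror image: [(r_i, 1) = r_{i+1}] and [(r_k, b_1) = b_0], then
    [(b_0, 1)], [(b_1, r_k)], [(b_2, r_k)] by swapping [b_2], [b_0], [b_1]. The second conjunct
    removes a case when partners are multiplied. *)
Lemma H_partner_gen k s : In s (gensH k) ->
  H k (mk false s (comp (gpow (par k s) (bfun k 1)) (gpow (beta k s) (rfun k)))) /\
  par k s && beta k s = false.
Proof.
  intros Hs; apply in_gensH in Hs; destruct Hs as [(i & Hi & ->) | (j & Hj & ->)].
  - rewrite par_rfun, beta_rfun, andb_false_r by auto; split; [|reflexivity].
    destruct (Nat.eqb_spec k i) as [<- | Hne].
    + apply H_rk_b1.
    + change (H k (mk false (rfun i) idm)); rewrite <- rfun_S; apply H_rfun; lia.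
  - destruct (par_bfun_small k k (le_n k)) as (P0 & P1 & P2).
    destruct (beta_bfun k) as (Q0 & Q1 & Q2).
    destruct j as [|[|[|]]]; [| | |lia];
      rewrite ?P0, ?P1, ?P2, ?Q0, ?Q1, ?Q2; (split; [|reflexivity]); apply H_mk_swap.
    + change (H k (mk false idm (bfun k 0))); rewrite <- bfun_2; apply H_bfun; lia.
    + apply H_rk_b1.
    + change (H k (mk false (rfun k) (bfun k 2))); rewrite <- bfun_1; apply H_bfun; lia.
Qed.

(** Partners of generators multiply along a word. The second coordinate returns to the normal form
    [b_1^p r_k^q] by moving [r_k] past [b_1], at the cost of commutators that [H] contains in that
    coordinate. *)
Lemma H_partner k h : 1 <= k -> H k h ->
  H k (mk false h (comp (gpow (par k h) (bfun k 1)) (gpow (beta k h) (rfun k)))).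
Proof.
  intros Hk; revert h; apply H_ind_left.
  - rewrite par_id, beta_id; change (H k (mk false idm idm)); rewrite mk_id; apply gen_id.
  - intros s h Hs Hh IH.
    assert (As := gensH_aut k s Hs); assert (Ah := H_aut k h Hh).
    rewrite par_comp, beta_comp by auto.
    destruct (H_partner_gen k s Hs) as [Es Hn].
    assert (E := H_mk_comp k _ _ _ _ Es IH).
    assert (R := rfun_invol k); assert (B := bfun_invol k 1 ltac:(lia)).
    destruct (par k s), (beta k s); try discriminate Hn; clear Hn.
    + rewrite <- (gpow_mul true (par k h) (bfun k 1)) by auto; exact E.
    + rewrite <- (gpow_mul true (beta k h) (rfun k)) by auto.
      (* If [s] contributes [r_k] and [h] contributes [b_1], the factor [b_1 r_k b_1 r_k] turns
         [r_k b_1] into [b_1 r_k]. *)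
      destruct (par k h); [|exact E].
      assert (F := H_mk_comp k _ _ _ _ (proj2 (H_commutator k Hk)) E).
      change (H k (mk false (comp s h)
        (comp (bfun k 1) (comp (rfun k) (comp (bfun k 1) (comp (comp (rfun k) (rfun k))
           (comp (bfun k 1) (gpow (beta k h) (rfun k))))))))) in F.
      rewrite R in F.
      change (H k (mk false (comp s h)
        (comp (bfun k 1) (comp (rfun k) (comp (comp (bfun k 1) (bfun k 1))
           (gpow (beta k h) (rfun k))))))) in F.
      rewrite B in F; exact F.
    + destruct (par k h), (beta k h); exact E.
Qed.

(** By the two equations the partners are [X = (h_0, b_1^p r_k^q)] and [Y = (b_1^q r_k^p, h_1)] with
    the same [p], [q]. The element [Z = (r_k^p b_1^q, r_k^q b_1^p)] cancels the surplus factors, so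
    [X Z Y = (h_0, h_1)]. *)
Lemma H_pair k h0 h1 : 1 <= k -> H k h0 -> H k h1 ->
  par k h0 = beta k h1 -> par k h1 = beta k h0 -> H k (mk false h0 h1).
Proof.
  intros Hk H0 H1 E0 E1.
  assert (X := H_partner k h0 Hk H0); assert (Y := H_mk_swap k _ _ (H_partner k h1 Hk H1)).
  rewrite E1, <- E0 in Y.
  set (p := par k h0) in *; set (q := beta k h0) in *.
  assert (R := rfun_invol k); assert (B := bfun_invol k 1 ltac:(lia)).
  assert (S1 := H_rk_b1 k); assert (S2 := H_mk_swap k _ _ S1).
  (* For [p = q = 1] the product [S1 S2] is [(r_k b_1, b_1 r_k)], and a commutator reverses its
     second coordinate; otherwise [Z] is [S1], [S2] or the identity. *)
  assert (Z : H k (mk false (comp (gpow p (rfun k)) (gpow q (bfun k 1)))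
                            (comp (gpow q (rfun k)) (gpow p (bfun k 1))))).
  { destruct p, q.
    - assert (F := H_mk_comp k _ _ _ _ (proj1 (H_commutator k Hk))
                     (H_mk_comp k _ _ _ _ S1 S2)).
      change (H k (mk false (comp (rfun k) (bfun k 1))
        (comp (rfun k) (comp (bfun k 1) (comp (rfun k)
           (comp (comp (bfun k 1) (bfun k 1)) (rfun k))))))) in F.
      rewrite B in F.
      change (H k (mk false (comp (rfun k) (bfun k 1))
        (comp (rfun k) (comp (bfun k 1) (comp (rfun k) (rfun k)))))) in F.
      rewrite R in F; exact F.
    - exact S1.
    - exact S2.
    - change (H k (mk false idm idm)); rewrite mk_id; apply gen_id. }
  assert (F := H_mk_comp k _ _ _ _ X (H_mk_comp k _ _ _ _ Z Y)).
  assert (I : forall e f, comp (gpow e (bfun k 1)) (comp (comp (gpow f (rfun k)) (gpow f (rfun k)))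
                (gpow e (bfun k 1))) = idm).
  { intros e f; rewrite gpow_mul, xorb_nilpotent by exact R.
    change (comp (gpow e (bfun k 1)) (gpow e (bfun k 1)) = idm).
    rewrite gpow_mul, xorb_nilpotent by exact B; reflexivity. }
  assert (I' : forall e f, comp (gpow f (rfun k)) (comp (comp (gpow e (bfun k 1)) (gpow e (bfun k 1)))
                (gpow f (rfun k))) = idm).
  { intros e f; rewrite gpow_mul, xorb_nilpotent by exact B.
    change (comp (gpow f (rfun k)) (gpow f (rfun k)) = idm).
    rewrite gpow_mul, xorb_nilpotent by exact R; reflexivity. }
  replace h0 with (comp h0 (comp (gpow p (rfun k)) (comp (comp (gpow q (bfun k 1))
    (gpow q (bfun k 1))) (gpow p (rfun k))))) by (rewrite I'; reflexivity).
  replace h1 with (comp (comp (gpow p (bfun k 1)) (comp (comp (gpow q (rfun k))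
    (gpow q (rfun k))) (gpow p (bfun k 1)))) h1) by (rewrite I; reflexivity).
  exact F.
Qed.

(** * The pattern group and the inclusion of [H] *)

(** The deepest level involved is level [k + 3] of [g], visible on words of length [k + 4]; the
    activity of the root is free. *)
Definition patP (k : nat) (g : tmap) : Prop :=
  is_aut g /\ par k (sect g [false]) = beta k (sect g [true]) /\
  par k (sect g [true]) = beta k (sect g [false]).

Lemma patP_mk k e g0 g1 : is_aut g0 -> is_aut g1 ->
  (patP k (mk e g0 g1) <-> par k g0 = beta k g1 /\ par k g1 = beta k g0).
Proof.
  intros H0 H1; unfold patP; rewrite !sect_mk; split; [tauto|].
  intros E; split; [now apply aut_mk | exact E].
Qed.

(** Both constraints are equations between homomorphisms to Z/2, and a swap of the two subtrees
    exchanges them. *)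
Lemma patP_group k : pattern_group (k + 4) (patP k).
Proof.
  assert (Hcomp : forall g h, patP k g -> patP k h -> patP k (comp g h)).
  { intros g h Pg Ph; generalize Pg Ph.
    assert (Ag := proj1 Pg); assert (Ah := proj1 Ph); clear Pg Ph.
    revert h Ah; pattern g; revert g Ag; refine (aut_cases _ _); intros e g0 g1 A0 A1.
    refine (aut_cases _ _); intros f h0 h1 B0 B1; rewrite mk_comp, !patP_mk by
      (first [assumption | apply aut_comp; destruct f; assumption]).
    intros [E0 E1] [F0 F1]; rewrite !par_comp, !beta_comp by (destruct f; auto).
    destruct f; rewrite E0, E1, F0, F1; auto. }
  assert (Hid : patP k idm).
  { rewrite <- mk_id; apply patP_mk; try apply aut_id; now rewrite par_id, beta_id. }
  split; [intros g; apply proj1 | split; [|split; [exact Hid | split; [exact Hcomp|]]]].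
  - intros g h (Ag & E0 & E1) Ah E; split; [exact Ah|].
    assert (F : forall x, eq_upto (k + 3) (sect g [x]) (sect h [x])).
    { intros x; apply eq_upto_sect; simpl; now replace (S (k + 3)) with (k + 4) by lia. }
    rewrite <- !(beta_eq_upto k (k + 3) _ _ (le_n _) (F _)).
    rewrite <- !(par_eq_upto k (k + 3) _ _ ltac:(lia) (F _)); auto.
  - intros g h Pg Hh.
    assert (Ag := proj1 Pg); assert (Ah := aut_inv g h Ag Hh).
    assert (E : comp g h = idm) by (apply functional_extensionality; intros w; apply Hh).
    clear Hh; revert Pg E; revert h Ah; pattern g; revert g Ag; apply aut_cases.
    intros e g0 g1 A0 A1; refine (aut_cases _ _); intros f h0 h1 B0 B1; rewrite !patP_mk by auto.
    intros [E0 E1] E.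
    (* The sections of [g h = 1] are trivial, so each [h_x] has the same invariants as the section
       of [g] that it meets. *)
    assert (F : forall x, sect (comp (mk e g0 g1) (mk f h0 h1)) [x] = idm)
      by (intros x; rewrite E; reflexivity).
    assert (F0 := F false); assert (F1 := F true); clear F.
    rewrite mk_comp, sect_mk in F0, F1.
    assert (P0 := f_equal (par k) F0); assert (P1 := f_equal (par k) F1).
    assert (Q0 := f_equal (beta k) F0); assert (Q1 := f_equal (beta k) F1).
    rewrite par_comp, par_id in P0, P1 by (destruct f; auto).
    rewrite beta_comp, beta_id in Q0, Q1 by (destruct f; auto).
    apply xorb_eq in P0, P1, Q0, Q1; destruct f; split; congruence.
Qed.

(** The section of a product is [(g h)_w = g_{h(w)} h_w], a product of two patterns. *)
Lemma G_P_comp d P g h : pattern_group d P -> G_P d P g -> G_P d P h -> G_P d P (comp g h).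
Proof.
  intros (_ & _ & _ & Hm & _) [Ag Hg] [Ah Hh]; split; [now apply aut_comp|].
  intros w.
  replace (sect (comp g h) w) with (comp (sect g (h w)) (sect h w)).
  - now apply (Hm (sect g (h w)) (sect h w)).
  - apply functional_extensionality; intros v; unfold sect at 3, comp at 2.
    rewrite (aut_app h w v Ah), (aut_app g _ _ Ag).
    rewrite <- (proj1 Ah w), <- (proj1 Ag (h w)), skipn_app, skipn_all, Nat.sub_diag.
    reflexivity.
Qed.

Lemma G_P_mk d P e g0 g1 : is_aut g0 -> is_aut g1 ->
  (G_P d P (mk e g0 g1) <-> P (mk e g0 g1) /\ G_P d P g0 /\ G_P d P g1).
Proof.
  intros A0 A1; split.
  - intros [A Hs]; split; [exact (Hs [])|].
    split; split; auto; intros w;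
      [specialize (Hs (false :: w)) | specialize (Hs (true :: w))];
      now rewrite sect_cons, sect_mk in Hs.
  - intros (P0 & [_ H0] & [_ H1]); split; [now apply aut_mk|].
    intros [|x w]; [exact P0|].
    rewrite sect_cons, sect_mk; destruct x; auto.
Qed.

Lemma G_P_id k : G_P (k + 4) (patP k) idm.
Proof.
  split; [apply aut_id|]; intros w.
  replace (sect idm w) with idm; [exact (proj1 (proj2 (proj2 (patP_group k))))|].
  apply functional_extensionality; intros v; unfold sect, idm.
  rewrite skipn_app, skipn_all, Nat.sub_diag; reflexivity.
Qed.

Lemma patP_rfun k i : i <= k -> patP k (rfun i).
Proof.
  intros Hi; destruct i as [|i]; rewrite ?rfun_0, ?rfun_S;
    apply patP_mk; auto using rfun_aut, aut_id; rewrite ?par_id, ?beta_id; auto.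
  rewrite par_rfun, beta_rfun, (proj2 (Nat.eqb_neq _ _)) by lia; auto.
Qed.

Lemma patP_bfun k j : j <= 2 -> patP k (bfun k j).
Proof.
  intros Hj.
  destruct (par_bfun_small k k (le_n k)) as (P0 & P1 & P2).
  destruct (beta_bfun k) as (Q0 & Q1 & Q2).
  destruct j as [|[|[|]]]; [rewrite bfun_0 | rewrite bfun_1 | rewrite bfun_2 | lia];
    apply patP_mk; auto using rfun_aut, aut_id, bfun_aut;
    rewrite ?par_rfun, ?beta_rfun, ?par_id, ?beta_id, ?Nat.eqb_refl, ?P0, ?P1, ?P2,
      ?Q0, ?Q1, ?Q2 by auto; auto.
Qed.

(** The generators and the identity form a finite automaton, so their patterns at all vertices
    reduce to patterns at the root. *)
Lemma sect_gensH k s x : s = idm \/ In s (gensH k) ->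
  sect s [x] = idm \/ In (sect s [x]) (gensH k).
Proof.
  rewrite !in_gensH; intros [-> | [([|i] & Hi & ->) | ([|[|[|]]] & Hj & ->)]].
  - now left.
  - left; rewrite rfun_0, sect_mk; now destruct x.
  - rewrite rfun_S, sect_mk; destruct x; [now left | right; left].
    exists i; split; [lia | reflexivity].
  - right; rewrite bfun_0, sect_mk; destruct x; [right; exists 1; auto | left; eauto].
  - right; rewrite bfun_1, sect_mk; destruct x; [right; exists 2; auto | left; eauto].
  - rewrite bfun_2, sect_mk; destruct x; [right; right; exists 0; auto | now left].
  - lia.
Qed.

Lemma H_G_P k h : H k h -> G_P (k + 4) (patP k) h.
Proof.
  revert h; apply H_ind_left; [apply G_P_id|].
  intros s h Hs _ Hh; apply G_P_comp; [apply patP_group | | exact Hh]; clear h Hh.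
  split; [now apply (gensH_aut k)|]; intros w.
  assert (Hs' : s = idm \/ In s (gensH k)) by auto; clear Hs; revert s Hs'.
  induction w as [|x w IH]; intros s Hs.
  - change (patP k s); destruct Hs as [-> | Hs]; [exact (proj1 (proj2 (proj2 (patP_group k))))|].
    apply in_gensH in Hs; destruct Hs as [(i & Hi & ->) | (j & Hj & ->)];
      auto using patP_rfun, patP_bfun.
  - rewrite sect_cons; apply IH; now apply sect_gensH.
Qed.

(** * Approximation by [H] and the closure of [H] *)

Lemma gpow_aut e g : is_aut g -> is_aut (gpow e g).
Proof. destruct e; auto using aut_id. Qed.

(* [b_2] changes [beta] without being visible on words of length [k + 2]. *)
Lemma adjust k e g : is_aut g -> exists u,
  let g' := comp g (gpow u (bfun k 2)) in
  par k g' = par k g /\ beta k g' = e /\ eq_upto (k + 2) g g'.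
Proof.
  intros Hg; exists (xorb (beta k g) e); simpl.
  destruct (par_bfun_small k k (le_n k)) as (_ & _ & P).
  destruct (beta_bfun k) as (_ & _ & Q).
  assert (A := gpow_aut (xorb (beta k g) e) _ (bfun_aut k 2 (le_n 2))).
  rewrite par_comp, beta_comp by auto.
  assert (E := bfun_2_upto k); replace (S (S k)) with (k + 2) in E by lia.
  split; [|split].
  - destruct (xorb (beta k g) e); simpl; rewrite ?P, ?par_id; apply xorb_false_r.
  - destruct (beta k g), e; simpl; rewrite ?Q, ?beta_id; reflexivity.
  - intros w Hw; unfold comp; destruct (xorb (beta k g) e); simpl; [|reflexivity].
    now rewrite E.
Qed.

(** The disjunction runs two claims through one induction: up to length [k + 3] every automorphism
    is approximated, beyond that those with the right patterns. Approximants of the two sections are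
    made compatible and joined by [H_pair]. *)
Lemma H_dense k n g : 1 <= k -> is_aut g -> n <= k + 3 \/ G_P (k + 4) (patP k) g ->
  exists h, H k h /\ eq_upto n g h.
Proof.
  intros Hk Hg; revert g Hg; induction n as [|n IH]; intros g Hg.
  - intros _; exists idm; split; [apply gen_id|].
    intros [|x w] Hw; [now apply aut_nil | simpl in Hw; lia].
  - pattern g; revert g Hg; refine (aut_cases _ _); intros e g0 g1 A0 A1 Hn.
    assert (Hn' : forall x : bool, n <= k + 3 \/ G_P (k + 4) (patP k) (if x then g1 else g0)).
    { destruct Hn as [Hn | Hn]; [left; lia | right].
      apply G_P_mk in Hn; auto; destruct x; apply Hn. }
    destruct (IH g0 A0 (Hn' false)) as (h0 & H0 & E0).
    destruct (IH g1 A1 (Hn' true)) as (h1 & H1 & E1); clear IH Hn'.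
    enough (F : exists h0' h1', H k h0' /\ H k h1' /\ eq_upto n g0 h0' /\ eq_upto n g1 h1' /\
              par k h0' = beta k h1' /\ par k h1' = beta k h0').
    { destruct F as (h0' & h1' & H0' & H1' & E0' & E1' & P0 & P1).
      exists (mk e h0' h1'); split; [now apply H_mk_sigma, H_pair | now apply eq_upto_mk]. }
    (* Here [n] bounds words in the sections. While [n <= k + 2], a power of [b_2] sets [beta] of
       each approximant to [par k] of the other one unseen. *)
    destruct (le_lt_dec n (k + 2)) as [Hle | Hlt].
    + destruct (adjust k (par k h1) h0 (H_aut k h0 H0)) as (u0 & P0 & Q0 & F0).
      destruct (adjust k (par k h0) h1 (H_aut k h1 H1)) as (u1 & P1 & Q1 & F1).
      assert (Hu : forall u, H k (gpow u (bfun k 2))).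
      { intros [|]; [apply H_bfun; lia | apply gen_id]. }
      exists (comp h0 (gpow u0 (bfun k 2))), (comp h1 (gpow u1 (bfun k 2))).
      split; [now apply H_comp | split; [now apply H_comp |]].
      split; [|split; [|split; congruence]]; intros w Hw;
        [rewrite E0 by auto; apply F0; lia | rewrite E1 by auto; apply F1; lia].
    (* Now [n >= k + 3], so the approximants share [par k] and [beta] with the sections of [g],
       which satisfy the constraints. *)
    + destruct Hn as [Hn | Hn]; [lia|].
      apply G_P_mk in Hn; auto; destruct Hn as [Hn _]; apply patP_mk in Hn; auto.
      exists h0, h1.
      rewrite <- (beta_eq_upto k n _ _ ltac:(lia) E0), <- (beta_eq_upto k n _ _ ltac:(lia) E1).
      rewrite <- (par_eq_upto k n _ _ ltac:(lia) E0), <- (par_eq_upto k n _ _ ltac:(lia) E1).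
      tauto.
Qed.

(** A pattern at [w] is read off words of length at most [|w| + k + 4], so a limit of elements of
    [H] inherits it from an approximant. *)
Lemma closure_H_iff k g : 1 <= k -> (closure (H k) g <-> G_P (k + 4) (patP k) g).
Proof.
  intros Hk; split.
  - intros [Ag Hg]; split; [exact Ag|]; intros w.
    destruct (Hg (length w + (k + 4))) as (h & Hh & E).
    destruct (H_G_P k h Hh) as [_ Ph].
    apply (proj1 (proj2 (patP_group k)) (sect h w)); [apply Ph | now apply aut_sect |].
    apply eq_upto_sect; intros v Hv; symmetry; now apply E.
  - intros Hg; split; [apply Hg|]; intros n; apply H_dense; auto; apply Hg.
Qed.

(** * Pattern size and finite generation *)

(** Multiplying both halves of any automorphism by powers of [b_2] brings it into the pattern group
    without changing words of length up to [k + 3]. *)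
Lemma patP_essential k : essential (k + 4) (patP k).
Proof.
  intros p i [Ap _].
  replace (k + 4 - 1) with (S (k + 2)) by lia.
  assert (A := aut_sect1 p i Ap); revert A; generalize (sect p [i]) as g; clear.
  refine (aut_cases _ _); intros e g0 g1 A0 A1.
  destruct (adjust k (par k g1) g0 A0) as (u0 & P0 & Q0 & F0).
  destruct (adjust k (par k g0) g1 A1) as (u1 & P1 & Q1 & F1).
  assert (Hu : forall u, is_aut (gpow u (bfun k 2))) by (intros; apply gpow_aut, bfun_aut; lia).
  eexists (mk e (comp g0 (gpow u0 (bfun k 2))) (comp g1 (gpow u1 (bfun k 2)))).
  split.
  - apply patP_mk; auto using aut_comp; split; congruence.
  - apply eq_upto_mk; repeat split; intros w Hw; symmetry; [now apply F0 | now apply F1].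
Qed.

Lemma closure_H_patterns k : 1 <= k -> defined_by_patterns_of_size (closure (H k)) (k + 4).
Proof.
  intros Hk; split.
  - exists (patP k); split; [apply patP_group | split; [apply patP_essential|]].
    intros g; now apply closure_H_iff.
  - intros d P Hd HP _ HK.
    (* The witness against smaller sizes is [r_{k+1} = (r_k, 1)]. It breaks a constraint, since
       [par k] is 1 on [r_k] and [beta] vanishes on the identity. Yet each of its sections agrees
       with an element of [H] up to length [k + 3], so smaller patterns would admit it. *)
    assert (A : is_aut (rfun (S k))) by apply rfun_aut.
    assert (F : closure (H k) (rfun (S k))).
    { apply HK; split; [exact A|]; intros w.
      destruct (H_dense k d (sect (rfun (S k)) w) Hk (aut_sect _ w A)) as (h & Hh & E);
        [left; lia|].
      destruct HP as (_ & Hsat & _).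
      apply (Hsat h); [|now apply aut_sect | intros v Hv; symmetry; now apply E].
      assert (Ch : closure (H k) h).
      { split; [now apply (H_aut k)|]; intros n; exists h; split; [exact Hh|].
        apply eq_upto_refl. }
      apply HK in Ch; exact (proj2 Ch []). }
    apply closure_H_iff in F; auto; destruct F as [_ F]; specialize (F []).
    change (patP k (rfun (S k))) in F; rewrite rfun_S in F.
    apply patP_mk in F; auto using rfun_aut, aut_id.
    rewrite par_rfun, Nat.eqb_refl, beta_id in F; destruct F; discriminate.
Qed.

Lemma closure_H_fin_gen k : top_fin_gen (closure (H k)).
Proof.
  exists (gensH k); split; [|auto].
  intros s Hs; split; [now apply (gensH_aut k)|].
  intros n; exists s; split; [now apply gen_base | apply eq_upto_refl].
Qed.

(** * Counting restrictions to finite levels *)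

Lemma in_words n w : In w (words n) <-> length w = n.
Proof.
  revert w; induction n as [|n IH]; intros w; simpl.
  - destruct w; simpl; split; auto; try lia; intros [E|[]]; discriminate.
  - rewrite in_app_iff, !in_map_iff; split.
    + intros [(v & <- & Hv) | (v & <- & Hv)]; simpl; f_equal; now apply IH.
    + destruct w as [|[] w]; intros E; try discriminate; injection E as E.
      * right; exists w; split; [reflexivity | now apply IH].
      * left; exists w; split; [reflexivity | now apply IH].
Qed.

Lemma in_words_upto n w : In w (words_upto n) <-> length w <= n.
Proof.
  unfold words_upto; rewrite in_flat_map; split.
  - intros (m & Hm & Hw); apply in_words in Hw; apply in_seq in Hm; lia.
  - intros Hw; exists (length w); split; [apply in_seq; lia | now apply in_words].
Qed.

Lemma eq_upto_restr n g h : eq_upto n g h <-> map g (words_upto n) = map h (words_upto n).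
Proof.
  rewrite map_ext_in_iff; split; intros E w Hw; apply E; now apply in_words_upto.
Qed.

Lemma eq_upto_sym n g h : eq_upto n g h -> eq_upto n h g.
Proof. intros E w Hw; symmetry; now apply E. Qed.

Lemma eq_upto_trans n g h f : eq_upto n g h -> eq_upto n h f -> eq_upto n g f.
Proof. intros E F w Hw; rewrite E by exact Hw; now apply F. Qed.

(** A system of representatives of [K] modulo [eq_upto n], so that counting can work with tree maps
    instead of lists of values. *)
Definition transversal (K : tmap -> Prop) (n : nat) (l : list tmap) : Prop :=
  NoDup l /\ (forall g, In g l -> K g) /\
  (forall g h, In g l -> In h l -> eq_upto n g h -> g = h) /\
  (forall g, K g -> exists h, In h l /\ eq_upto n g h).

Lemma level_card_transversal K n m :
  level_card K n m <-> exists l, transversal K n l /\ length l = m.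
Proof.
  split.
  - intros (s & Hnd & <- & Hs).
    (* Chooses a preimage in [K] for each restriction in the list. *)
    assert (L : forall s', (forall f, In f s' -> In f s) -> exists l,
        map (fun g => map g (words_upto n)) l = s' /\ forall g, In g l -> K g).
    { induction s' as [|f s' IH]; intros Hs'.
      - exists []; split; [reflexivity | intros g []].
      - destruct IH as (l & E & Hl); [intros; apply Hs'; now right|].
        destruct (proj1 (Hs f) (Hs' f (or_introl eq_refl))) as (g & Hg & <-).
        exists (g :: l); split; [exact (f_equal (cons _) E)|].
        intros h [<- | Hh]; auto. }
    destruct (L s (fun f H => H)) as (l & <- & Hl); clear L.
    exists l; split; [|now rewrite length_map].
    split; [now apply NoDup_map_inv in Hnd | split; [exact Hl | split]].
    + intros g h Hg Hh E; apply eq_upto_restr in E.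
      revert g h Hg Hh E; clear Hs Hl; induction l as [|x l IH]; [intros g h []|].
      simpl in Hnd; apply NoDup_cons_iff in Hnd; destruct Hnd as [Hx Hnd].
      intros g h [<- | Hg] [<- | Hh] E.
      * reflexivity.
      * destruct Hx; apply in_map_iff; exists h; auto.
      * destruct Hx; apply in_map_iff; exists g; auto.
      * exact (IH Hnd g h Hg Hh E).
    + intros g Hg; assert (F : In (map g (words_upto n)) (map (fun g => map g (words_upto n)) l))
        by (apply Hs; eauto).
      apply in_map_iff in F; destruct F as (h & E & Hh); exists h; split; [exact Hh|].
      now apply eq_upto_restr.
  - intros (l & (Hnd & HK & Hinj & Hsurj) & <-).
    exists (map (fun g => map g (words_upto n)) l); split; [|split; [apply length_map|]].
    + apply NoDup_map_NoDup_ForallPairs; [|exact Hnd].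
      intros g h Hg Hh E; apply Hinj; auto; now apply eq_upto_restr.
    + intros f; rewrite in_map_iff; split.
      * intros (g & <- & Hg); eauto.
      * intros (g & Hg & <-); destruct (Hsurj g Hg) as (h & Hh & E).
        exists h; split; [|exact Hh]; now apply eq_upto_restr, eq_upto_sym.
Qed.

Lemma level_card_unique K n a b : level_card K n a -> level_card K n b -> a = b.
Proof.
  intros (s & Hs & <- & Es) (t & Ht & <- & Et).
  apply Permutation_length, NoDup_Permutation; auto.
  intros f; rewrite Es, Et; reflexivity.
Qed.

(** The hypotheses make [f] induce a bijection from the classes of [K] on level [n] to those of [L]
    on level [n']. *)
Lemma level_card_image (f : tmap -> tmap) K L n n' m :
  (forall g, K g -> L (f g)) ->
  (forall g h, K g -> K h -> eq_upto n' (f g) (f h) <-> eq_upto n g h) ->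
  (forall t, L t -> exists g, K g /\ eq_upto n' t (f g)) ->
  level_card K n m -> level_card L n' m.
Proof.
  intros HL Hf Hsurj; rewrite !level_card_transversal.
  intros (l & (Hnd & HK & Hinj & Hs) & <-).
  exists (map f l); split; [|apply length_map].
  split; [|split; [|split]].
  - apply NoDup_map_NoDup_ForallPairs; [|exact Hnd].
    intros g h Hg Hh E; apply Hinj; auto; apply Hf; auto; rewrite E; apply eq_upto_refl.
  - intros t Ht; apply in_map_iff in Ht; destruct Ht as (g & <- & Hg); auto.
  - intros t u Ht Hu E; apply in_map_iff in Ht, Hu.
    destruct Ht as (g & <- & Hg), Hu as (h & <- & Hh); f_equal.
    apply Hinj; auto; apply Hf; auto.
  - intros t Ht; destruct (Hsurj t Ht) as (g & Hg & E); destruct (Hs g Hg) as (h & Hh & F).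
    exists (f h); split; [now apply in_map|].
    apply (eq_upto_trans _ _ _ _ E); apply Hf; auto.
Qed.

Lemma level_card_ext K L n m :
  (forall g, K g -> L g) -> (forall g, L g -> exists h, K h /\ eq_upto n g h) ->
  level_card K n m -> level_card L n m.
Proof.
  intros HL HK; apply (level_card_image (fun g => g)); [exact HL | reflexivity | exact HK].
Qed.

Lemma level_card_sub K L n a :
  level_card K n a -> (forall g, L g -> K g) -> exists m, level_card L n m.
Proof.
  intros (s & Hnd & _ & Hs) HL.
  assert (F : forall (Q : list word -> Prop) s, NoDup s -> exists s', NoDup s' /\
    forall f, In f s' <-> In f s /\ Q f).
  { clear; intros Q s; induction s as [|x s IH]; intros Hnd.
    - exists []; split; [constructor | simpl; tauto].
    - apply NoDup_cons_iff in Hnd; destruct Hnd as [Hx Hnd].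
      destruct (IH Hnd) as (s' & Hnd' & Hs').
      destruct (classic (Q x)) as [Qx | Qx].
      + exists (x :: s'); split.
        * constructor; [rewrite Hs'; tauto | exact Hnd'].
        * intros f; simpl; rewrite Hs'; intuition congruence.
      + exists s'; split; [exact Hnd'|].
        intros f; simpl; rewrite Hs'; intuition congruence. }
  destruct (F (fun f => exists g, L g /\ map g (words_upto n) = f) s Hnd) as (s' & Hnd' & Hs').
  exists (length s'), s'; split; [exact Hnd' | split; [reflexivity|]].
  intros f; rewrite Hs', Hs; split; [tauto|].
  intros (g & Hg & E); split; eauto.
Qed.

Lemma level_card_bool (K : bool -> tmap -> Prop) n m :
  (forall g h, K false g -> K true h -> ~ eq_upto n g h) ->
  (forall b, level_card (K b) n m) -> level_card (fun g => exists b, K b g) n (2 * m).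
Proof.
  intros Hdisj Hc; destruct (Hc false) as (s & Hs & Ls & Es), (Hc true) as (t & Ht & Lt & Et).
  exists (s ++ t); split; [|split].
  - apply NoDup_app; auto; intros f Hf Hf'; apply Es in Hf; apply Et in Hf'.
    destruct Hf as (g & Hg & E), Hf' as (h & Hh & F).
    apply (Hdisj g h); auto; apply eq_upto_restr; congruence.
  - rewrite length_app; lia.
  - intros f; rewrite in_app_iff, Es, Et; split.
    + intros [(g & Hg & E) | (g & Hg & E)]; eauto.
    + intros (g & ([|] & Hg) & E); eauto.
Qed.

Lemma level_card_mk e K L n a b : level_card K n a -> level_card L n b ->
  level_card (fun t => exists g h, K g /\ L h /\ t = mk e g h) (S n) (a * b).
Proof.
  rewrite !level_card_transversal.
  intros (l & (Nl & Kl & Il & Sl) & <-) (l' & (Nl' & Ll' & Il' & Sl') & <-).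
  assert (I : forall g h g' h', In (g, h) (list_prod l l') -> In (g', h') (list_prod l l') ->
     eq_upto (S n) (mk e g h) (mk e g' h') -> g = g' /\ h = h').
  { intros g h g' h' H1 H2 E; apply in_prod_iff in H1, H2; apply eq_upto_mk in E.
    destruct E as (_ & E & F), H1, H2; auto. }
  exists (map (fun p => mk e (fst p) (snd p)) (list_prod l l')); split;
    [|now rewrite length_map, length_prod].
  split; [|split; [|split]].
  - apply NoDup_map_NoDup_ForallPairs.
    + intros [g h] [g' h'] H1 H2 E; simpl in E.
      destruct (I g h g' h' H1 H2) as [-> ->]; [rewrite E; apply eq_upto_refl | reflexivity].
    + clear - Nl Nl'; induction Nl as [|x l Hx Nl IH]; simpl; [constructor|].
      apply NoDup_app; [|exact IH|].
      * apply NoDup_map_NoDup_ForallPairs; [|exact Nl']; intros u v _ _ E; congruence.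
      * intros [u v] Hu Hv; apply in_map_iff in Hu; destruct Hu as (y & E & _).
        apply in_prod_iff in Hv; destruct Hv as [Hv _]; congruence.
  - intros t Ht; apply in_map_iff in Ht; destruct Ht as ([g h] & <- & Hp).
    apply in_prod_iff in Hp; exists g, h; simpl; intuition.
  - intros t u Ht Hu E; apply in_map_iff in Ht, Hu.
    destruct Ht as ([g h] & <- & H1), Hu as ([g' h'] & <- & H2); simpl in *.
    destruct (I g h g' h') as [-> ->]; auto.
  - intros t (g & h & Hg & Hh & ->).
    destruct (Sl g Hg) as (g' & Hg' & E), (Sl' h Hh) as (h' & Hh' & F).
    exists (mk e g' h'); split; [|now apply eq_upto_mk].
    apply in_map_iff; exists (g', h'); split; [reflexivity|]; now apply in_prod.
Qed.

Lemma level_card_mk_bool K L n a b : level_card K n a -> level_card L n b ->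
  level_card (fun t => exists e g h, K g /\ L h /\ t = mk e g h) (S n) (2 * (a * b)).
Proof.
  intros HK HL.
  apply (level_card_bool (fun e t => exists g h, K g /\ L h /\ t = mk e g h)).
  - intros t u (g & h & _ & _ & ->) (g' & h' & _ & _ & ->) E.
    apply eq_upto_mk in E; destruct E; discriminate.
  - intros e; now apply level_card_mk.
Qed.

(** A root bit and two independent sections give [|G(n+1)| = 2 |G(n)|^2]. *)
Lemma level_card_aut n : level_card is_aut n (2 ^ (2 ^ n - 1)).
Proof.
  induction n as [|n IH].
  - exists [[[]]]; split; [|split; [reflexivity|]].
    + constructor; [intros [] | constructor].
    + intros f; unfold words_upto; simpl; split.
      * intros [<- | []]; exists idm; split; [apply aut_id | reflexivity].
      * intros (g & Hg & <-); left; now rewrite aut_nil.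
  - assert (E := level_card_mk_bool _ _ _ _ _ IH IH).
    replace (2 ^ (2 ^ S n - 1)) with (2 * (2 ^ (2 ^ n - 1) * 2 ^ (2 ^ n - 1))).
    + revert E; apply level_card_ext.
      * intros t (e & g & h & Hg & Hh & ->); now apply aut_mk.
      * refine (aut_cases _ _); intros e g h Hg Hh; exists (mk e g h).
        split; [eauto 8 | apply eq_upto_refl].
    + rewrite <- Nat.pow_add_r, <- Nat.pow_succ_r'; f_equal; simpl.
      assert (2 ^ n <> 0) by (apply Nat.pow_nonzero; lia); lia.
Qed.

(** * Orders of the level quotients of the closure *)

Lemma closure_H_comp k g h : 1 <= k ->
  closure (H k) g -> closure (H k) h -> closure (H k) (comp g h).
Proof.
  intros Hk; rewrite !closure_H_iff by exact Hk; apply G_P_comp, patP_group.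
Qed.

Lemma H_closure k g : H k g -> closure (H k) g.
Proof.
  intros Hg; split; [now apply (H_aut k)|]; intros n; exists g; split; [exact Hg|].
  apply eq_upto_refl.
Qed.

Lemma closure_H_mk k e g h : 1 <= k ->
  (closure (H k) (mk e g h) <-> closure (H k) g /\ closure (H k) h /\
     par k g = beta k h /\ par k h = beta k g).
Proof.
  intros Hk; rewrite !closure_H_iff by exact Hk; split.
  - intros Hm; destruct (aut_mk_rev e g h (proj1 Hm)) as [Ag Ah].
    rewrite G_P_mk, patP_mk in Hm by auto; tauto.
  - intros (Hg & Hh & E); rewrite G_P_mk, patP_mk by (apply Hg || apply Hh); tauto.
Qed.

Definition parity_class (k : nat) (a b : bool) (g : tmap) : Prop :=
  closure (H k) g /\ par k g = a /\ beta k g = b.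

(** The four classes are cosets: left multiplication by [t = r_k^a b_1^b] carries the class [(0, 0)]
    onto the class [(a, b)], with inverse [t']. *)
Lemma level_card_class k a b n m : 1 <= k ->
  level_card (parity_class k false false) n m -> level_card (parity_class k a b) n m.
Proof.
  intros Hk.
  pose (t := comp (gpow a (rfun k)) (gpow b (bfun k 1))).
  pose (t' := comp (gpow b (bfun k 1)) (gpow a (rfun k))).
  assert (Hr : H k (gpow a (rfun k))) by (destruct a; [now apply H_rfun | apply gen_id]).
  assert (Hb : H k (gpow b (bfun k 1))) by (destruct b; [apply H_bfun; lia | apply gen_id]).
  assert (Ht := H_comp k _ _ Hr Hb : H k t); assert (Ht' := H_comp k _ _ Hb Hr : H k t').
  assert (I : comp t t' = idm).
  { unfold t, t'.
    change (comp (gpow a (rfun k)) (comp (comp (gpow b (bfun k 1)) (gpow b (bfun k 1)))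
              (gpow a (rfun k))) = idm).
    rewrite gpow_mul, xorb_nilpotent by (apply bfun_invol; lia).
    change (comp (gpow a (rfun k)) (gpow a (rfun k)) = idm).
    now rewrite gpow_mul, xorb_nilpotent by apply rfun_invol. }
  assert (I' : comp t' t = idm).
  { unfold t, t'.
    change (comp (gpow b (bfun k 1)) (comp (comp (gpow a (rfun k)) (gpow a (rfun k)))
              (gpow b (bfun k 1))) = idm).
    rewrite gpow_mul, xorb_nilpotent by apply rfun_invol.
    change (comp (gpow b (bfun k 1)) (gpow b (bfun k 1)) = idm).
    now rewrite gpow_mul, xorb_nilpotent by (apply bfun_invol; lia). }
  assert (Par : par k t = a /\ beta k t = b).
  { unfold t; rewrite par_comp, beta_comp by eauto using H_aut.
    destruct (par_bfun_small k k (le_n k)) as (_ & P & _).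
    destruct (beta_bfun k) as (_ & Q & _).
    destruct a, b; simpl; rewrite ?P, ?Q, ?par_rfun, ?Nat.eqb_refl, ?beta_rfun, ?par_id,
      ?beta_id by auto; auto. }
  destruct Par as [Pt Qt]; assert (At := H_aut k t Ht).
  apply (level_card_image (comp t)).
  - intros g (Hg & P & Q); split; [apply closure_H_comp; auto using H_closure|].
    rewrite par_comp, beta_comp, P, Q, Pt, Qt by (auto; apply Hg).
    now rewrite !xorb_false_r.
  - intros g h _ _; split; intros E w Hw; specialize (E w Hw); unfold comp in E |- *.
    + apply (f_equal t') in E.
      change (comp t' t (g w) = comp t' t (h w)) in E; now rewrite I' in E.
    + now rewrite E.
  - intros u (Hu & P & Q); exists (comp t' u).
    assert (E : comp t (comp t' u) = u) by (change (comp (comp t t') u = u); now rewrite I).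
    split; [|rewrite E; apply eq_upto_refl].
    split; [apply closure_H_comp; auto using H_closure|].
    assert (Au := aut_comp t' u (H_aut k t' Ht') (proj1 Hu)).
    assert (E1 := f_equal (par k) E); assert (E2 := f_equal (beta k) E).
    rewrite par_comp, Pt, P in E1 by auto; rewrite beta_comp, Qt, Q in E2 by auto.
    destruct (par k (comp t' u)), (beta k (comp t' u)), a, b; auto.
Qed.

(** From level [k + 3] on the two invariants are visible, so the four cosets are disjoint there and
    have [m] elements each. A section of class [(a, b)] forces class [(b, a)] on the other one; with
    the root bit this gives [2 * 4 * m^2], which is [c^2 / 2]. *)
Lemma level_card_closure_step k n c : 1 <= k -> k + 3 <= n ->
  level_card (closure (H k)) n c ->
  exists m, c = 4 * m /\ level_card (closure (H k)) (S n) (8 * (m * m)).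
Proof.
  intros Hk Hn Hc.
  destruct (level_card_sub _ (parity_class k false false) _ _ Hc) as [m Hm]; [intros g; apply proj1|].
  assert (Hab := fun a b => level_card_class k a b n m Hk Hm); clear Hm.
  assert (D : forall a b a' b' g h, parity_class k a b g -> parity_class k a' b' h -> eq_upto n g h ->
            a = a' /\ b = b').
  { intros a b a' b' g h (_ & <- & <-) (_ & <- & <-) E; split.
    - apply (par_eq_upto k n); [lia | exact E].
    - now apply (beta_eq_upto k n). }
  exists m; split.
  - apply (level_card_unique _ _ _ _ Hc); replace (4 * m) with (2 * (2 * m)) by lia.
    apply (level_card_ext (fun g => exists a b, parity_class k a b g)).
    + intros g (a & b & Hg); apply Hg.
    + intros g Hg; exists g; split; [|apply eq_upto_refl].
      exists (par k g), (beta k g); now split.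
    + apply (level_card_bool (fun a g => exists b, parity_class k a b g)).
      * intros g h (b & Hg) (b' & Hh) E.
        destruct (D _ _ _ _ _ _ Hg Hh E); discriminate.
      * intros a; apply (level_card_bool (parity_class k a)); [|apply Hab].
        intros g h Hg Hh E; destruct (D _ _ _ _ _ _ Hg Hh E); discriminate.
  - replace (8 * (m * m)) with (2 * (2 * (2 * (m * m)))) by lia.
    apply (level_card_ext (fun t => exists a b e g h,
             parity_class k a b g /\ parity_class k b a h /\ t = mk e g h)).
    + intros t (a & b & e & g & h & (Hg & <- & <-) & (Hh & E & F) & ->).
      now apply closure_H_mk.
    + intros t Ht; exists t; split; [|apply eq_upto_refl].
      revert Ht; destruct (classic (is_aut t)) as [At|At]; [|now intros [At' _]].
      revert t At; refine (aut_cases _ _); intros e g h _ _ Ht.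
      apply closure_H_mk in Ht; auto; destruct Ht as (Hg & Hh & E & F).
      exists (par k g), (beta k g), e, g, h.
      split; [now split | split; [now split | reflexivity]].
    + apply (level_card_bool (fun a t => exists b e g h,
             parity_class k a b g /\ parity_class k b a h /\ t = mk e g h)).
      * intros t u (b & e & g & h & Hg & _ & ->) (b' & e' & g' & h' & Hg' & _ & ->) E.
        apply eq_upto_mk in E; destruct (D _ _ _ _ _ _ Hg Hg' (proj1 (proj2 E))); discriminate.
      * intros a; apply (level_card_bool (fun b t => exists e g h,
             parity_class k a b g /\ parity_class k b a h /\ t = mk e g h)).
        -- intros t u (e & g & h & Hg & _ & ->) (e' & g' & h' & Hg' & _ & ->) E.
           apply eq_upto_mk in E; destruct (D _ _ _ _ _ _ Hg Hg' (proj1 (proj2 E))); discriminate.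
        -- intros b; now apply level_card_mk_bool.
Qed.

Lemma level_card_closure_small k n : 1 <= k -> n <= k + 3 ->
  level_card (closure (H k)) n (2 ^ (2 ^ n - 1)).
Proof.
  intros Hk Hn.
  destruct (level_card_sub _ (closure (H k)) _ _ (level_card_aut n)) as [m Hm];
    [intros g; apply proj1|].
  rewrite (level_card_unique is_aut n _ m (level_card_aut n)); [exact Hm|].
  revert Hm; apply level_card_ext; [intros g; apply proj1|].
  intros g Hg; destruct (H_dense k n g Hk Hg) as (h & Hh & E); [auto|].
  exists h; split; [now apply H_closure | exact E].
Qed.

(** The exponents satisfy [e_{n+1} = 2 e_n - 1] with [e_{k+3} = 2^(k+3) - 1]; the formula is the
    solution of this recursion. *)
Lemma level_card_closure_large k j : 1 <= k ->
  level_card (closure (H k)) (k + 3 + j) (2 ^ (2 ^ (k + 3 + j) + 1 - 2 * 2 ^ j)).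
Proof.
  intros Hk; induction j as [|j IH].
  - replace (2 ^ (k + 3 + 0) + 1 - 2 * 2 ^ 0) with (2 ^ (k + 3 + 0) - 1) by (simpl; lia).
    apply level_card_closure_small; lia.
  - destruct (level_card_closure_step k (k + 3 + j) _ Hk ltac:(lia) IH) as (m & E & Hm).
    replace (k + 3 + S j) with (S (k + 3 + j)) by lia.
    replace (2 ^ (2 ^ S (k + 3 + j) + 1 - 2 * 2 ^ S j)) with (8 * (m * m)); [exact Hm|].
    assert (B : 2 ^ j <= 2 ^ (k + 3 + j)) by (apply Nat.pow_le_mono_r; lia).
    (* Keeps the natural-number subtractions in the exponents from truncating. *)
    assert (B' : 8 * 2 ^ j <= 2 ^ (k + 3 + j)).
    { replace (k + 3 + j) with (k + (3 + j)) by lia.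
      rewrite (Nat.pow_add_r 2 k), (Nat.pow_add_r 2 3).
      assert (2 ^ k <> 0) by (apply Nat.pow_nonzero; lia).
      change (2 ^ 3) with 8; nia. }
    assert (P := Nat.pow_nonzero 2 j ltac:(lia)).
    rewrite !Nat.pow_succ_r'.
    remember (2 ^ (k + 3 + j)) as d eqn:Ed; remember (2 ^ j) as q eqn:Eq.
    clear - E B' P.
    assert (F : 2 * 2 ^ (2 * d + 1 - 2 * (2 * q)) = 2 ^ (d + 1 - 2 * q) * 2 ^ (d + 1 - 2 * q)).
    { rewrite <- Nat.pow_succ_r', <- Nat.pow_add_r; f_equal; lia. }
    rewrite E in F; nia.
Qed.

(** * The Hausdorff dimension *)

Lemma ln_pow2 e : (ln (INR (2 ^ e)) / ln 2 = INR e)%R.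
Proof.
  assert (L : (0 < ln 2)%R) by (rewrite <- ln_1; apply ln_increasing; lra).
  rewrite pow_INR; change (INR 2) with 2%R; rewrite ln_pow by lra; field; lra.
Qed.

Lemma is_liminf_of_cv (u : nat -> R) (L : R) : Un_cv u L -> is_liminf u L.
Proof.
  intros Hu; split.
  - intros eps Heps; destruct (Hu eps Heps) as [N HN]; exists N; intros n Hn.
    specialize (HN n Hn); unfold Rdist in HN; apply Rabs_def2 in HN; lra.
  - intros eps Heps N; destruct (Hu eps Heps) as [M HM]; exists (max N M); split; [lia|].
    specialize (HM (max N M) ltac:(lia)); unfold Rdist in HM; apply Rabs_def2 in HM; lra.
Qed.

Lemma pow2_ge n : (INR n + 1 <= 2 ^ n)%R.
Proof.
  induction n as [|n IH]; [simpl; lra|].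
  rewrite S_INR; simpl; assert (H := pos_INR n); lra.
Qed.

Lemma closure_H_hdim k : 1 <= k ->
  hdim_is (closure (H k)) (1 - 2 / 2 ^ (k + 3))%R.
Proof.
  intros Hk.
  (* The binary logarithm of the order on level [n]; the two formulas agree at [n = k + 3]. *)
  pose (e := fun n => if n <=? k + 3 then 2 ^ n - 1 else 2 ^ n + 1 - 2 * 2 ^ (n - (k + 3))).
  exists (fun n => 2 ^ e n), (fun n => 2 ^ (2 ^ n - 1)); split; [|split].
  - intros n; unfold e; destruct (Nat.leb_spec n (k + 3)) as [Hn | Hn].
    + now apply level_card_closure_small.
    + assert (E := level_card_closure_large k (n - (k + 3)) Hk).
      now replace (k + 3 + (n - (k + 3))) with n in E by lia.
  - exact level_card_aut.
  - apply is_liminf_of_cv; intros eps Heps.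
    (* The error will be at most [2 / N], hence the choice of [eps / 2]. *)
    destruct (archimed_cor1 (eps / 2) ltac:(lra)) as (N & HN & HN0).
    exists (N + (k + 4)); intros n Hn; rewrite !ln_pow2.
    pose (j := n - (k + 3)).
    assert (Ej : n = k + 3 + j) by (unfold j; lia).
    unfold e; rewrite (proj2 (Nat.leb_gt _ _)) by lia; fold j.
    assert (B : 2 * 2 ^ j <= 2 ^ n).
    { rewrite <- Nat.pow_succ_r'; apply Nat.pow_le_mono_r; lia. }
    assert (B0 := Nat.pow_nonzero 2 j ltac:(lia)).
    rewrite minus_INR, plus_INR, mult_INR, minus_INR, !pow_INR by lia.
    change (INR 2) with 2%R; change (INR 1) with 1%R.
    assert (ED : (2 ^ n = 2 ^ (k + 3) * 2 ^ j)%R) by (rewrite Ej; apply pow_add).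
    assert (D1 : (INR N + 1 <= 2 ^ n)%R).
    { apply Rle_trans with (INR n + 1)%R; [|apply pow2_ge].
      apply Rplus_le_compat_r, le_INR; lia. }
    assert (N0 : (0 < INR N)%R) by (apply lt_0_INR; lia).
    assert (P1 : (0 < 2 ^ (k + 3))%R) by (apply pow_lt; lra).
    assert (P2 : (0 < 2 ^ j)%R) by (apply pow_lt; lra).
    set (D := (2 ^ n)%R) in *; set (M := (2 ^ j)%R) in *; set (A := (2 ^ (k + 3))%R) in *.
    assert (EL : (2 / A = 2 * M / D)%R) by (rewrite ED; field; lra).
    rewrite EL; unfold Rdist.
    (* The exact error: the factor [(D - M) / D] is at most 1, and [D - 1 >= N]. *)
    replace ((D + 1 - 2 * M) / (D - 1) - (1 - 2 * M / D))%R
      with (2 * ((D - M) / D) * / (D - 1))%R by (field; lra).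
    assert (B' : (0 < M <= D)%R).
    { split; [exact P2|]; apply le_INR in B; rewrite mult_INR, !pow_INR in B.
      change (INR 2) with 2%R in B; fold D M in B; lra. }
    assert (Q : (0 <= (D - M) / D <= 1)%R).
    { split; [apply Rle_mult_inv_pos; lra|].
      apply Rmult_le_reg_r with D; [lra|].
      replace ((D - M) / D * D)%R with (D - M)%R by (field; lra); lra. }
    assert (I : (0 < / (D - 1) <= / INR N)%R).
    { split; [apply Rinv_0_lt_compat; lra | apply Rinv_le_contravar; lra]. }
    rewrite Rabs_right by nra; nra.
Qed.

Theorem theorem4 (k : nat) (hk : (1 <= k)%nat) :
  let d := (k + 4)%nat in
  top_fin_gen (closure (H k)) /\
  defined_by_patterns_of_size (closure (H k)) d /\
  hdim_is (closure (H k)) (1 - 2 / 2 ^ (d - 1))%R.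
Proof.
  intros d; split; [apply closure_H_fin_gen | split; [now apply closure_H_patterns|]].
  unfold d; replace (k + 4 - 1) with (k + 3) by lia; now apply closure_H_hdim.
Qed.
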